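(* Let $k \geq 4$ be an even integer. Then $h(n,k) \leq \frac{n(3k+8)(k-2)}{4(3k-4)}$ for every positive integer $n$ with $n \equiv 0 \pmod{\frac{3k-4}{2}}$.
   Context: All graphs are finite and simple. A degree monotone path in a graph $G$ is a path $v_1v_2\ldots v_m$ such that $\deg(v_1)\le \cdots\le \deg(v_m)$ or $\deg(v_1)\ge \cdots\ge \deg(v_m)$; its length is its number of vertices. $mp(G)$ denotes the maximum length of a degree monotone path in $G$. For a pair $e$ of non-adjacent vertices, $G+e$ is $G$ with the edge $e$ added. A graph $G$ is $k$-saturated if $mp(G)\le k-1$ and $mp(G+e)\ge k$ for every pair $e$ of non-adjacent vertices of $G$ (so $K_m$ is $k$-saturated for $m\le k-1$). $h(n,k)$ is the minimum number of edges of a $k$-saturated graph on $n$ vertices. *)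

(* Defs.v *)
From mathcomp Require Import all_boot.
Set Implicit Arguments. Unset Strict Implicit. Unset Printing Implicit Defensive.

Definition graph (n : nat) := {ffun 'I_n * 'I_n -> bool}.

Definition simple_graph n (G : graph n) : bool :=
  [forall x, ~~ G (x, x)] && [forall x, forall y, G (x, y) == G (y, x)].

Definition deg n (G : graph n) (x : 'I_n) : nat := #|[set y | G (x, y)]|.

Definition nedges n (G : graph n) : nat :=
  #|[set p : 'I_n * 'I_n | G p && (p.1 < p.2)]|.

Definition add_edge n (G : graph n) (x y : 'I_n) : graph n :=
  [ffun p => [|| G p, p == (x, y) | p == (y, x)]].

Definition is_dmp n (G : graph n) (p : seq 'I_n) : bool :=
  if p is x :: q then
    [&& path (fun a b => G (a, b)) x q, uniq p &
        sorted leq (map (deg G) p) || sorted (fun a b => b <= a) (map (deg G) p)]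
  else false.

(* mp(G): maximum length of a degree monotone path (paths have at most n
   vertices since they are vertex-distinct) *)
Definition mp n (G : graph n) : nat :=
  \max_(m < n.+1 | [exists p : m.-tuple 'I_n, is_dmp G p]) m.

Definition saturated (k : nat) n (G : graph n) : bool :=
  (mp G <= k - 1) &&
  [forall x, forall y, ((x != y) && ~~ G (x, y)) ==> (k <= mp (add_edge G x y))].

(* h(n,k): minimum number of edges of a k-saturated simple graph on n
   vertices (default 'C(n,2).+1, exceeding every edge count, if none exists) *)
Definition h (n k : nat) : nat :=
  \big[minn/'C(n, 2).+1]_(G : graph n | simple_graph G && saturated k G) nedges G.

(* Main.v *)
(** Write k = 2s + 2. Take a graph whose vertices are partitioned into cliques: low
    classes consist of vertices of degree s + 1, the others ("cores") of vertices
    of larger degree, and edges between different classes join a low class to a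
    core. A degree monotone path then visits at most one low class and after it
    one core, so mp <= 2s + 1 as soon as the sizes of adjacent classes add up to
    at most 2s + 1.

    A hub block has 3s + 1 vertices: an apex joined to the Cartesian product of
    K_s and the path P_3. A disjoint union of several hub blocks is not saturated
    for s >= 2 (join a core vertex of one block to the apex of another), so at
    most one is used, when n / (3s + 1) is odd. The other vertices are grouped
    into pair blocks of 6s + 2 vertices: two cores K_s with all degrees s + 2,
    three low cliques K_{s+1} whose vertices have one core neighbour each, and a
    low clique K_{s-1} whose vertices have three. Raising the degree of a low
    vertex x to s + 2 allows it to follow a core in a monotone path: a full low
    clique, then a core adjacent to x, then x, which is one vertex too many. Two
    nonadjacent core vertices are handled in the same way. *)

Require Import Defs.
From mathcomp Require Import all_boot.
From mathcomp Require Import zify.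
Set Implicit Arguments. Unset Strict Implicit. Unset Printing Implicit Defensive.

(** * Degree monotone paths over an arbitrary finite vertex type *)

Definition vdeg (T : finType) (e : rel T) (x : T) : nat := #|[set y | e x y]|.

Definition with_edge (T : finType) (e : rel T) (x y : T) : rel T :=
  fun a b => [|| e a b, (a == x) && (b == y) | (a == y) && (b == x)].

(** Only nondecreasing paths are recorded, since by symmetry a nonincreasing path can be read
    backwards. *)
Definition completes (T : finType) (e : rel T) (k : nat) (x y : T) : Prop :=
  exists p, [/\ sorted (with_edge e x y) p, uniq p,
    sorted leq (map (vdeg (with_edge e x y)) p) & k <= size p].

Lemma completesC (T : finType) (e : rel T) (k : nat) (x y : T) :
  completes e k x y -> completes e k y x.
Proof.
have eE : with_edge e x y =2 with_edge e y x.
  by move=> a b; rewrite /with_edge [in RHS]orbCA orbA orbC orbA orbAC.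
have dE : vdeg (with_edge e x y) =1 vdeg (with_edge e y x).
  by move=> a; apply: eq_card => b; rewrite !inE eE.
move=> [p [pa un so sz]]; exists p; split=> //.
  by rewrite -(eq_sorted eE).
by rewrite -(eq_map dE).
Qed.

Lemma vdeg_with_edge (T : finType) (e : rel T) (x y a : T) :
  symmetric e -> x != y -> ~~ e x y ->
  vdeg (with_edge e x y) a = vdeg e a + (a == x) + (a == y).
Proof.
move=> se nxy exy; rewrite /vdeg /with_edge.
have eyx : ~~ e y x by rewrite se.
case: (eqVneq a x) => [->|ax].
  rewrite (negbTE nxy) addn0 addn1.
  rewrite (_ : [set _ | _] = y |: [set b | e x b]) ?cardsU1 ?inE ?exy //.
  by apply/setP=> b; rewrite !inE /= orbF orbC.
case: (eqVneq a y) => [->|ay].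
  rewrite addn0 addn1.
  rewrite (_ : [set _ | _] = x |: [set b | e y b]) ?cardsU1 ?inE ?eyx //.
  by apply/setP=> b; rewrite !inE /= orbC.
by rewrite !addn0; apply: eq_card => b; rewrite !inE !orbF.
Qed.

(** * From relations on a finite type to graphs on ordinals *)

Section Transfer.
Variables (T : finType) (n : nat) (phi : 'I_n -> T) (psi : T -> 'I_n).
Hypotheses (phiK : cancel phi psi) (psiK : cancel psi phi).
Variables (G : graph n) (e : rel T).
Hypothesis Ge : forall a b, G (a, b) = e (phi a) (phi b).

Lemma deg_transfer a : deg G a = vdeg e (phi a).
Proof.
rewrite /deg /vdeg -(card_imset _ (can_inj phiK)).
apply: eq_card => b; rewrite inE; apply/imsetP/idP => [[c]|eb].
  by rewrite inE Ge => ? ->.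
by exists (psi b); rewrite ?inE ?Ge psiK.
Qed.

(** A nonincreasing path reversed is a nondecreasing path, because [e] is symmetric, so a bound on
    the nondecreasing ones is enough. *)
Lemma mp_le k : symmetric e ->
  (forall p, sorted e p -> uniq p -> sorted leq (map (vdeg e) p) ->
     size p <= k) ->
  mp G <= k.
Proof.
move=> se H; apply/bigmax_leqP => m /existsP [p].
case: p => p /= /eqP <- {m}.
rewrite -(size_map phi); case: p => // x q /and3P[pa un so].
have pa' : sorted e (map phi (x :: q)).
  by rewrite /= path_map; apply: sub_path pa => a b; rewrite Ge.
have un' : uniq (map phi (x :: q)) by rewrite map_inj_uniq //; exact: can_inj phiK.
have dE : map (vdeg e) (map phi (x :: q)) = map (deg G) (x :: q).
  by rewrite -map_comp; apply: eq_map => a; rewrite /= deg_transfer.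
case/orP: so => so; first by apply: H => //; rewrite dE.
rewrite -size_rev; apply: H; rewrite ?rev_uniq //.
  by rewrite rev_sorted; rewrite (eq_sorted (e' := e)) // => a b; rewrite se.
by rewrite map_rev rev_sorted dE.
Qed.

Lemma mp_ge p : sorted e p -> uniq p -> sorted leq (map (vdeg e) p) ->
  size p <= mp G.
Proof.
case: p => // x q pa un so.
set p := map psi (x :: q).
have un' : uniq p by rewrite map_inj_uniq //; exact: can_inj psiK.
(* The maximum in [mp] ranges over lengths at most [n]; a path without repetition fits in that
   range. *)
have sz : size p < n.+1.
  by rewrite ltnS -[X in _ <= X]card_ord -(card_uniqP un') max_card.
have -> : size (x :: q) = Ordinal sz by rewrite /= size_map.
apply: (leq_bigmax_cond (Ordinal sz)); apply/existsP; exists (in_tuple p).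
rewrite /p /= in un' *; apply/and3P; split=> //.
  by rewrite path_map; apply: sub_path pa => a b eab; rewrite /= Ge !psiK.
apply/orP; left; move: so; rewrite /= !path_map.
by apply: sub_path => a b /=; rewrite !deg_transfer !psiK.
Qed.

End Transfer.

(** The adjacent ordered pairs split into the increasing ones [A], counted by [nedges], and the
    decreasing ones [B]; swapping coordinates matches the two. *)
Lemma handshake n (G : graph n) : simple_graph G ->
  2 * nedges G = \sum_x deg G x.
Proof.
case/andP=> /forallP irr /forallP sym.
have symE x y : G (x, y) = G (y, x) by apply/eqP; exact: (forallP (sym x)).
pose A := [set p : 'I_n * 'I_n | G p && (p.1 < p.2)].
pose B := [set p : 'I_n * 'I_n | G p && (p.2 < p.1)].
pose swap (p : 'I_n * 'I_n) := (p.2, p.1).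
have swapK : cancel swap swap by case.
have BA : #|B| = #|A|.
  rewrite -(card_imset A (can_inj swapK)); apply: eq_card => [[a b]].
  rewrite inE /=; apply/idP/imsetP => [H|[[c d]]].
    by exists (b, a); rewrite // inE /= symE.
  by rewrite inE /= => H [-> ->]; rewrite symE.
have dAB : [disjoint A & B].
  rewrite -setI_eq0; apply/eqP/setP => [[a b]]; rewrite !inE /=.
  by case: (ltngtP a b); rewrite !(andbF, andbT).
have -> : \sum_x deg G x = #|A :|: B|.
  rewrite (eq_bigr (fun x => \sum_(y | G (x, y)) 1)); last first.
    by move=> x _; rewrite sum1_card; apply: eq_card => y; rewrite !inE.
  rewrite pair_big_dep /= sum1_card; apply: eq_card => [[a b]].
  rewrite !inE /= -andb_orr -neq_ltn.
  rewrite [LHS](_ : _ = G (a, b)) //.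
  case: (eqVneq a b) => [->|ab]; first by rewrite eqxx andbF (negbTE (irr b)).
  by rewrite (_ : nat_of_ord a != b) ?andbT.
have := leq_card_setU A B; rewrite dAB => /leqifP /eqP ->.
by rewrite BA addnn mul2n.
Qed.

Lemma h_le n k (G : graph n) : simple_graph G -> saturated k G -> h n k <= nedges G.
Proof.
move=> sG kG; have PG : simple_graph G && saturated k G by rewrite sG kG.
rewrite /h; have : G \in index_enum (graph n) by rewrite mem_index_enum.
elim: (index_enum _) => // G' r IH; rewrite inE big_cons => /orP [/eqP <-|/IH le].
  by rewrite PG geq_minl.
by case: ifP => // _; exact: leq_trans (geq_minr _ _) le.
Qed.

(** Interface to the construction: the vertices may form any finite type, numbered here by
    [enum_val], and edges are counted only through the degree sum, whence the factor 2. *)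
Lemma h_le_vdeg (T : finType) (e : rel T) (k : nat) :
  symmetric e -> irreflexive e ->
  (forall p, sorted e p -> uniq p -> sorted leq (map (vdeg e) p) ->
     size p <= k - 1) ->
  (forall x y, x != y -> ~~ e x y -> completes e k x y) ->
  2 * h #|T| k <= \sum_x vdeg e x.
Proof.
move=> se ie up lo.
pose G : graph #|T| := [ffun p => e (enum_val p.1) (enum_val p.2)].
have Ge a b : G (a, b) = e (enum_val a) (enum_val b) by rewrite ffunE.
have sG : simple_graph G.
  apply/andP; split; first by apply/forallP=> x; rewrite Ge ie.
  by apply/forallP=> x; apply/forallP=> y; rewrite !Ge se.
have kG : saturated k G.
  apply/andP; split.
    exact: (mp_le (@enum_valK T) (@enum_rankK T) Ge).
  apply/forallP=> x; apply/forallP=> y; apply/implyP=> /andP[nxy].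
  rewrite Ge => exy.
  case: (lo (enum_val x) (enum_val y)); rewrite ?(inj_eq enum_val_inj) //.
  move=> p [pa un so sz]; apply: leq_trans sz _.
  apply: (mp_ge (@enum_valK T) (@enum_rankK T) _ pa un so) => a b.
  rewrite ffunE Ge /with_edge !xpair_eqE !(inj_eq enum_val_inj) //.
apply: leq_trans (leq_mul (leqnn 2) (h_le sG kG)) _.
rewrite (handshake sG) [X in _ <= X](reindex (@enum_val T predT)) /=; last first.
  by apply: onW_bij; exact: enum_val_bij.
apply: leq_sum => a _.
by rewrite (deg_transfer (@enum_valK T) (@enum_rankK T) Ge).
Qed.

(** * Upper bound on degree monotone paths *)

(** A step between two low vertices or between two cores stays in its class, and a step from a core
    down to a low vertex would lower [f]. Hence the path consists of vertices of one low class
    followed by vertices of one core. *)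
Lemma dmp_bound (T : finType) (J : eqType) (e : rel T) (low : pred T)
    (cls : T -> J) (f : T -> nat) (k : nat) (p : seq T) :
  (forall x y, cls x = cls y -> low x = low y) ->
  (forall x y, e x y -> low x = low y -> cls x = cls y) ->
  (forall x y, e x y -> ~~ low x -> low y -> f y < f x) ->
  (forall x, #|[set z | cls z == cls x]| <= k) ->
  (forall x y, e x y -> low x -> ~~ low y ->
     #|[set z | cls z == cls x]| + #|[set z | cls z == cls y]| <= k) ->
  sorted e p -> uniq p -> sorted leq (map f p) -> size p <= k.
Proof.
move=> cls_low e_cls e_f sz1 sz2 pa un so.
pose C x := #|[set z | cls z == cls x]|.
have CE x y : cls x = cls y -> C x = C y by rewrite /C => ->.
(* [R a b] records what remains true when [b] comes anywhere after [a]. For low [a] and core [b] it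
   keeps the bound on the class sizes instead of adjacency, which makes [R] transitive. *)
pose R a b := if low a then (if low b then cls a == cls b else C a + C b <= k)
  else ~~ low b && (cls a == cls b).
have Rtr : transitive R.
  rewrite /R => b a c; case: (low a); case: (low b); case: (low c) => //=;
    rewrite ?andbF //.
  - by move=> /eqP ->.
  - by move=> /eqP /CE ->.
  - by move=> + /eqP /CE <-.
  - by move=> /eqP ->.
have {pa so} pR : sorted R p.
  case: p pa so {un} => //= x q pa so.
  have : path (fun a b => e a b && (f a <= f b)) x q.
    elim: q x pa so => //= y q IH x /andP[-> pa] /andP[-> so] /=; exact: IH.
  apply: sub_path => a b /andP[eab fab]; rewrite /R.
  case la: (low a); case lb: (low b); rewrite /=.
  - by apply/eqP; apply: e_cls => //; rewrite la lb.
  - by apply: sz2; rewrite ?la ?lb.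
  - by have := e_f a b eab (negbT la) lb; rewrite ltnNge fab.
  - by apply/eqP; apply: e_cls => //; rewrite la lb.
have sub q x : uniq q -> (forall z, z \in q -> cls z = cls x) -> size q <= C x.
  move=> uq H; rewrite -(card_uniqP uq); apply: subset_leq_card.
  by apply/subsetP=> z /H zx; rewrite inE zx.
have fwd q x : sorted R (x :: q) -> forall z, z \in x :: q -> z = x \/ R x z.
  move=> + z => /= /(order_path_min Rtr) /allP H; rewrite inE => /orP[/eqP ->|/H]; tauto.
have hfwd q x : ~~ low x -> sorted R (x :: q) ->
    forall z, z \in x :: q -> cls z = cls x.
  move=> lx pq z /(fwd q x pq z) [->//|].
  by rewrite /R (negbTE lx) => /andP[_ /eqP].
case: p pR un => // x q pR un.
case: (boolP (low x)) => lx; last first.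
  by apply: leq_trans (sz1 x); apply: sub un _ => z; exact: hfwd.
(* The path starts low: its low vertices all lie in the class of [x], and its core vertices in the
   class of the first core [y]. *)
rewrite -(count_predC low) -!size_filter.
have lowC : size (filter low (x :: q)) <= C x.
  apply: sub; first exact: filter_uniq.
  move=> z; rewrite mem_filter => /andP[lz /(fwd q x pR z) [->//|]].
  by rewrite /R lx lz => /eqP.
have : sorted R (filter (predC low) (x :: q)) by exact: sorted_filter.
have : uniq (filter (predC low) (x :: q)) by exact: filter_uniq.
have : forall z, z \in filter (predC low) (x :: q) -> ~~ low z /\ z \in x :: q.
  by move=> z; rewrite mem_filter => /andP.
case: (filter (predC low) _) => [|y r] H uy sy.
  by rewrite addn0; exact: leq_trans lowC (sz1 x).
have [ly yp] := H y (mem_head _ _).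
have : size (y :: r) <= C y by apply: sub uy _ => z; exact: hfwd.
have : C x + C y <= k.
  case: (fwd q x pR y yp) => [E|]; first by rewrite E lx in ly.
  by rewrite /R lx (negbTE ly).
by move=> le1 le2; apply: leq_trans le1; exact: leq_add.
Qed.

(** * Monotone paths with prescribed ends and vertex set *)

Section Route.
Variables (T : finType) (e : rel T) (f : T -> nat).

(** Recording the visited set [S] turns length and absence of repetition into statements on
    cardinals and disjointness; the bounds [lo] and [hi] let monotonicity of a concatenation be
    checked by one comparison. *)
Definition route (lo hi : nat) (S : {set T}) (a b : T) : Prop :=
  exists p, [/\ path e a p, last a p = b, uniq (a :: p) &
    sorted leq (map f (a :: p))] /\
    (forall z, z \in S = (z \in a :: p)) /\
    (forall z, z \in S -> lo <= f z <= hi).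

Lemma route1 x : route (f x) (f x) [set x] x x.
Proof.
exists [::]; split=> //; split=> z; first by rewrite !inE.
by rewrite inE => /eqP ->; rewrite leqnn.
Qed.

Lemma route_cat l1 h1 l2 h2 (S1 S2 : {set T}) a b c d :
  route l1 h1 S1 a b -> route l2 h2 S2 c d -> e b c -> h1 <= l2 ->
  [disjoint S1 & S2] -> route l1 h2 (S1 :|: S2) a d.
Proof.
move=> [p [[pa la pu ps] [pS pb]]] [q [[qa lb qu qs] [qS qb]]] ebc h12 dis.
exists (p ++ c :: q); split; [split|split].
- by rewrite cat_path pa /= la ebc.
- by rewrite last_cat.
- rewrite -cat_cons cat_uniq pu qu andbT andTb; apply/hasPn => z.
  rewrite -qS => zS; rewrite -topredE /= -[_ || _]/(z \in a :: p) -pS.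
  by rewrite (disjointFl dis zS).
- rewrite -cat_cons map_cat (sorted_pairwise leq_trans) pairwise_cat.
  rewrite -!(sorted_pairwise leq_trans) ps qs !andbT.
  apply/allrelP => _ _ /mapP[z zp ->] /mapP[w wq ->].
  rewrite -pS in zp; rewrite -qS in wq.
  case/andP: (pb _ zp) => _ hz; case/andP: (qb _ wq) => hw _.
  exact: leq_trans hz (leq_trans h12 hw).
- by move=> z; rewrite -cat_cons mem_cat inE pS qS.
(* Both sets are nonempty, so [l1 <= h1 <= l2 <= h2], which extends the bounds to the union. *)
have /pb /andP[a1 a2] : a \in S1 by rewrite pS mem_head.
have /qb /andP[c1 c2] : c \in S2 by rewrite qS mem_head.
move=> z; rewrite inE => /orP[/pb|/qb] /andP[z1 z2]; apply/andP; split=> //.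
  exact: leq_trans z2 (leq_trans h12 (leq_trans c1 c2)).
exact: leq_trans a1 (leq_trans a2 (leq_trans h12 z1)).
Qed.

(** In a clique every ordering of the vertices is a path, so the other vertices, all of value [v],
    may be listed arbitrarily between [a] and [b]. Only the last vertex [b] may have a larger value,
    and [a = b] is possible only for a singleton. *)
Lemma clique_route v v' (S : {set T}) a b :
  a \in S -> b \in S -> (a != b) || (#|S| <= 1) ->
  {in S &, forall x y, x != y -> e x y} ->
  (forall z, z \in S -> z != b -> f z = v) -> v <= f b -> f b <= v' ->
  route v v' S a b.
Proof.
move=> aS bS ab cl fv vb bv'.
have bnd z : z \in S -> v <= f z <= v'.
  by case: (eqVneq z b) => [-> _|zb zS]; rewrite ?vb // (fv _ zS zb); lia.
case: (eqVneq a b) ab => [ab /= S1|nab _].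
  exists [::]; split=> //; split=> // z.
  rewrite inE; apply/idP/eqP => [zS|->//].
  by move/card_le1_eqP: S1; apply.
exists (rcons (enum (S :\ a :\ b)) b); split; [split|split=> //].
- have cl' : all (fun z => z \in S) (enum (S :\ a :\ b)).
    by apply/allP => z; rewrite mem_enum !inE => /and3P[].
  have aN : a \notin enum (S :\ a :\ b) by rewrite mem_enum !inE eqxx andbF.
  have bN : b \notin enum (S :\ a :\ b) by rewrite mem_enum !inE eqxx.
  have := enum_uniq (mem (S :\ a :\ b)).
  move: (enum (S :\ a :\ b)) cl' aN bN => s; clear fv.
  elim: s a aS nab => /= [|z q IH] a' aS nab cl' aN bN un; first by rewrite cl.
  case/andP: cl' => zS qS; case/andP: un => zq un.
  rewrite !inE !negb_or in aN bN; case/andP: aN => az aq; case/andP: bN => bz bq.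
  by rewrite cl //= IH // eq_sym.
- by rewrite last_rcons.
- rewrite /= mem_rcons rcons_uniq enum_uniq !mem_enum !inE !eqxx /=.
  by rewrite mem_enum !inE eqxx (negbTE nab) ?andbF.
- rewrite map_cons map_rcons -rcons_cons -cats1 (sorted_pairwise leq_trans).
  rewrite pairwise_cat /= !andbT; apply/and3P; split.
  + rewrite /allrel /= fv // vb /=; apply/allP=> _ /mapP[z + ->].
    by rewrite mem_enum !inE => /and3P[zb _ zS]; rewrite fv //= vb.
  + apply/allP=> _ /mapP[z + ->]; rewrite mem_enum !inE => /and3P[zb _ zS].
    by rewrite !fv.
  + rewrite pairwise_map; apply/(pairwiseP a) => i j; rewrite !inE => si sj _ /=.
    have zS k : k < size (enum (S :\ a :\ b)) ->
      f (nth a (enum (S :\ a :\ b)) k) = v.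
      move=> /(mem_nth a); rewrite mem_enum !inE => /and3P[zb _ zS]; exact: fv.
    by rewrite !zS.
move=> z; rewrite inE mem_rcons inE mem_enum !inE.
case: (eqVneq z a) => [->|_] //=; case: (eqVneq z b) => [->|_] //=.
Qed.

Lemma clique_route_to v v' (S : {set T}) b :
  b \in S -> {in S &, forall x y, x != y -> e x y} ->
  (forall z, z \in S -> z != b -> f z = v) -> v <= f b -> f b <= v' ->
  exists a, route v v' S a b.
Proof.
move=> bS cl fv vb bv'.
case: (set_0Vmem (S :\ b)) => [S0|[a]].
  exists b; apply: clique_route => //.
  by rewrite eqxx (cardsD1 b) bS S0 cards0.
by rewrite !inE => /andP[ab aS]; exists a; apply: clique_route; rewrite ?ab.
Qed.

Lemma clique_route_from v (S : {set T}) a :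
  a \in S -> {in S &, forall x y, x != y -> e x y} ->
  (forall z, z \in S -> f z = v) -> exists b, route v v S a b.
Proof.
move=> aS cl fv.
have R b : b \in S -> (a != b) || (#|S| <= 1) -> route v v S a b.
  by move=> bS ab; apply: clique_route => // [z zS _||]; rewrite ?fv.
case: (set_0Vmem (S :\ a)) => [S0|[b]].
  by exists a; apply: R; rewrite // eqxx (cardsD1 a) aS S0 cards0.
by rewrite !inE => /andP[ba bS]; exists b; apply: R; rewrite // eq_sym ba.
Qed.

Lemma route_dmp lo hi S a b : route lo hi S a b ->
  exists p, [/\ sorted e p, uniq p, sorted leq (map f p) & #|S| <= size p].
Proof.
move=> [p [[pa _ un so] [pS _]]]; exists (a :: p); split=> //.
by rewrite (eq_card pS) (card_uniqP un).
Qed.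

End Route.

Lemma card_disjointU (T : finType) (A B : {set T}) :
  [disjoint A & B] -> #|A :|: B| = #|A| + #|B|.
Proof. by move=> d; have /leqifP := leq_card_setU A B; rewrite d => /eqP. Qed.

(** * Saturation of unions of cliques *)

Lemma double_succ s : 2 * s + 2 = s.+1 + s.+1.
Proof. lia. Qed.

Section Saturation.
Variables (T : finType) (J : eqType) (e : rel T) (cls : T -> J).
Variables (low hb : pred T) (s : nat).
Hypothesis e_sym : symmetric e.
Hypothesis cls_low : forall x y, cls x = cls y -> low x = low y.
Hypothesis cls_hb : forall x y, cls x = cls y -> hb x = hb y.
Hypothesis cls_e : forall x y, cls x = cls y -> x != y -> e x y.
Hypothesis vdeg_low : forall x, low x -> vdeg e x = s.+1.
Hypothesis vdeg_high : forall x, ~~ low x -> s.+2 <= vdeg e x.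

Let K x := [set z | cls z == cls x].

Hypothesis pair_core : forall u, ~~ low u -> ~~ hb u ->
  vdeg e u = s.+2 /\ #|K u| = s.
Hypothesis pair_nbr : forall x, low x -> ~~ hb x ->
  exists c, [/\ ~~ low c, ~~ hb c & e x c].
(** Provides the start of a long path: a full low clique outside the class of [x], with an entry [r]
    into the core of [c]. The last condition is the one under which [clique_route] crosses that core
    from [r] to [c] with [y] left out. *)
Hypothesis pair_link : forall x c y, ~~ low c -> ~~ hb c -> y != c ->
  exists b r, [/\ low b, #|K b| = s.+1, cls b <> cls x, e b r & cls r = cls c] /\
    r != y /\ (r != c) || (#|K c :\ y| <= 1).
(** Expresses that there is at most one hub block: two core vertices in hubs share a class, so they
    are equal or adjacent. *)
Hypothesis hub_core : forall u v, ~~ low u -> ~~ low v -> hb u -> hb v ->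
  cls u = cls v.
Hypothesis hub_low : forall x, low x -> hb x -> #|K x| = s.
(** Here [w] is the apex and [c] another core neighbour of [x]. The apex has degree [3 * s], which
    is at least [s + 3] except for [s = 1]. The last clause is the hub analogue of [pair_link], for
    the core without its apex. *)
Hypothesis hub_link : forall x, low x -> hb x -> exists c w,
  [/\ ~~ low w, cls c = cls w, c != w, e x c & e x w] /\
  [/\ #|K w| = s.+1, forall u, cls u = cls w -> u != w -> vdeg e u = s.+2 &
    s = 1 \/ s.+3 <= vdeg e w] /\
  forall y, y != c -> exists b r,
    [/\ low b, hb b, cls b <> cls x, e b r & cls r = cls w] /\
    [/\ r != w, r != y & (r != c) || (#|K w :\ w :\ y| <= 1)].

(** * Long paths after adding one edge *)

Section Pair.
Variables x y : T.
Hypotheses (nxy : x != y) (exy : ~~ e x y).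

Let e' := with_edge e x y.
Let f' := vdeg e'.

Let f'E a : f' a = vdeg e a + (a == x) + (a == y).
Proof. exact: vdeg_with_edge. Qed.

Let ee' a b : e a b -> e' a b.
Proof. by rewrite /e' /with_edge => ->. Qed.

Let exy' : e' x y.
Proof. by rewrite /e' /with_edge !eqxx orbT. Qed.

Let eyx' : e' y x.
Proof. by rewrite /e' /with_edge !eqxx !orbT. Qed.

Let cl z (S : {set T}) : S \subset K z ->
  {in S &, forall a b, a != b -> e' a b}.
Proof.
move=> /subsetP SK a b /SK; rewrite inE => /eqP az /SK; rewrite inE => /eqP bz ab.
by apply/ee'/cls_e; rewrite // az bz.
Qed.

Let cls_xy : cls x <> cls y.
Proof. by move=> E; case/negP: exy; exact: cls_e. Qed.

Let Kx z : z \in K z. Proof. by rewrite inE. Qed.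

Let completes_route lo hi S a b : route e' f' lo hi S a b -> 2 * s + 2 <= #|S| ->
  completes e (2 * s + 2) x y.
Proof. by case/route_dmp=> p [? ? ? ?] le; exists p; split=> //; exact: leq_trans le _. Qed.

Let cls_neq a b : cls a <> cls b -> (a == b) = false.
Proof. by move=> H; apply/eqP=> E; apply: H; rewrite E. Qed.

Let low_neq a b : low a -> ~~ low b -> cls a <> cls b.
Proof. by move=> la lb /cls_low E; rewrite -E la in lb. Qed.

(** The path runs through [K y] with the raised vertex [y] last, takes the new edge to [x], then
    sweeps the core adjacent to [x]: [(s + 1) + 1 + s] vertices. *)
Lemma completes_pair_full : low x -> ~~ hb x -> low y -> #|K y| = s.+1 ->
  completes e (2 * s + 2) x y.
Proof.
move=> lx hx ly Ky; have [c [lc hc exc]] := pair_nbr lx hx.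
have [dc Kc] := pair_core lc hc.
have xc := low_neq lx lc; have yc := low_neq ly lc.
have nyx : (y == x) = false by rewrite eq_sym (negbTE nxy).
have fx : f' x = s.+2 by rewrite f'E vdeg_low // eqxx (negbTE nxy) addn0 addn1.
have fy : f' y = s.+2 by rewrite f'E vdeg_low // eqxx nyx addn0 addn1.
have [a r1] : exists a, route e' f' s.+1 s.+2 (K y) a y.
  apply: clique_route_to; rewrite ?fy //; first exact: cl.
  move=> z; rewrite inE => /eqP zy zny.
  rewrite f'E vdeg_low ?(cls_low zy) // (negbTE zny) cls_neq ?zy ?addn0 //.
  exact/nesym.
have [d r2] : exists d, route e' f' s.+2 s.+2 (K c) c d.
  apply: clique_route_from; rewrite ?inE //; first exact: cl.
  move=> z; rewrite inE => /eqP zc.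
  have [] := @pair_core z; rewrite ?(cls_low zc) ?(cls_hb zc) // => dz _.
  by rewrite f'E dz !cls_neq ?zc ?addn0 //; exact/nesym.
have rx := route1 e' f' x; rewrite fx in rx.
have d1 : [disjoint [set x] & K c] by rewrite disjoints1 inE; apply/eqP.
have d2 : [disjoint K y & [set x] :|: K c].
  apply/pred0P => z; apply/negbTE/negP; rewrite /= !inE.
  by case/andP=> /eqP zy /orP[/eqP zx|/eqP]; [apply: cls_xy; rewrite -zx|rewrite zy].
have r3 := route_cat rx r2 (ee' exc) (leqnn _) d1.
apply: completes_route (route_cat r1 r3 eyx' (leqnn _) d2) _.
by rewrite !card_disjointU // cards1 Ky Kc add1n double_succ.
Qed.

(* The sweep [B, K c, x] reaches size [2s+2] because raising the degree of [x]
   lets it follow the core; if [y] lies in that core it is postponed to the end. *)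
Lemma completes_pair_sweep : low x -> ~~ hb x ->
  (low y -> #|K y| <> s.+1) -> completes e (2 * s + 2) x y.
Proof.
move=> lx hx Ky; have [c [lc hc exc]] := pair_nbr lx hx.
have [dc Kc] := pair_core lc hc.
have xc := low_neq lx lc.
have nyx : (y == x) = false by rewrite eq_sym (negbTE nxy).
have yc : y != c by apply: contraNneq exy => ->.
have [b [r [[lb Kb bx ebr rc] [ry rK]]]] := pair_link x lc hc yc.
have bc := low_neq lb lc.
(* The class of [b] is a full low clique, which by hypothesis does not contain [y]; so no degree
   changes inside it. *)
have yb : cls y <> cls b.
  move=> E; case: Ky; first by rewrite (cls_low E).
  by rewrite /K E.
have fx : f' x = s.+2 by rewrite f'E vdeg_low // eqxx (negbTE nxy) addn0 addn1.
have fB z : z \in K b -> f' z = s.+1.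
  rewrite inE => /eqP zb; rewrite f'E vdeg_low ?(cls_low zb) //.
  by rewrite !cls_neq ?zb ?addn0 //; exact/nesym.
have dK z : z \in K c -> vdeg e z = s.+2.
  rewrite inE => /eqP zc.
  by have [] := @pair_core z; rewrite ?(cls_low zc) ?(cls_hb zc).
have [a r1] : exists a, route e' f' s.+1 s.+1 (K b) a b.
  by apply: clique_route_to; rewrite ?fB //; [exact: cl|move=> z /fB].
have r2 : route e' f' s.+2 s.+2 (K c :\ y) r c.
  have fC z : z \in K c :\ y -> f' z = s.+2.
    rewrite 2!inE => /andP[zy zc]; rewrite f'E dK // (negbTE zy) cls_neq ?addn0 //.
    by move: zc; rewrite inE => /eqP ->; exact/nesym.
  have cS : c \in K c :\ y by rewrite 2!inE eq_sym yc Kx.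
  apply: clique_route => //; rewrite ?fC //.
  - by rewrite !inE ry rc eqxx.
  - by apply: cl; exact: subsetDl.
  - by move=> z /fC.
have rx := route1 e' f' x; rewrite fx in rx.
have ecx : e' c x by apply: ee'; rewrite e_sym.
have xK : x \notin K c by rewrite inE; apply/eqP.
have xB : x \notin K b by rewrite inE; apply/eqP/nesym.
have bK z : z \in K b -> z \notin K c.
  by rewrite !inE => /eqP ->; apply/eqP.
case: (boolP (y \in K c)) => yK; last first.
  have E : K c :\ y = K c by apply/setDidPl; rewrite disjoint_sym disjoints1.
  rewrite E in r2.
  have d1 : [disjoint K c & [set x]] by rewrite disjoint_sym disjoints1.
  have d2 : [disjoint K b & K c :|: [set x]].
    apply/pred0P => z; apply/negbTE/negP => /= /andP[zb].
    by rewrite 2!inE (negbTE (bK _ zb)) /= => /eqP E'; rewrite -E' zb in xB.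
  have r3 := route_cat r2 rx ecx (leqnn _) d1.
  apply: completes_route (route_cat r1 r3 (ee' ebr) (leqnSn _) d2) _.
  by rewrite !card_disjointU // cards1 Kb Kc addn1 double_succ.
have fy : f' y = s.+3 by rewrite f'E dK // eqxx nyx addn0 addn1.
have ry' := route1 e' f' y; rewrite fy in ry'.
have d0 : [disjoint [set x] & [set y]] by rewrite disjoints1 inE.
have d1 : [disjoint K c :\ y & [set x] :|: [set y]].
  apply/pred0P => z; apply/negbTE/negP; rewrite /= 2!inE => /andP[/andP[zy zK]].
  by rewrite !inE (negbTE zy) orbF => /eqP E'; rewrite -E' zK in xK.
have d2 : [disjoint K b & (K c :\ y) :|: ([set x] :|: [set y])].
  apply/pred0P => z; apply/negbTE/negP => /= /andP[zb].
  rewrite !in_setU !in_set1 in_setD1 (negbTE (bK _ zb)) andbF /=.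
  case/orP=> /eqP E'; first by rewrite -E' zb in xB.
  by have := bK _ zb; rewrite E' yK.
have r4 := route_cat rx ry' exy' (leqnSn _) d0.
have r3 := route_cat r2 r4 ecx (leqnn _) d1.
apply: completes_route (route_cat r1 r3 (ee' ebr) (leqnSn _) d2) _.
have := cardsD1 y (K c); rewrite yK Kc add1n => sE.
rewrite !card_disjointU // !cards1 Kb double_succ sE.
by rewrite addn2.
Qed.

(** The path runs through a full low clique, then the core of [x] ending at [x], whose degree is now
    [s + 3], then the new edge to [y], whose degree is at least that: [(s + 1) + s + 1] vertices. *)
Lemma completes_core : ~~ low x -> ~~ hb x -> ~~ low y ->
  completes e (2 * s + 2) x y.
Proof.
move=> lx hx ly; have [dx Kc] := pair_core lx hx.
have [b [r [[lb Kb ebr rx] rK]]] : exists b r,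
  [/\ low b, #|K b| = s.+1, e b r & cls r = cls x] /\
    ((r != x) || (#|K x| <= 1)).
  have nyx : y != x by rewrite eq_sym.
  have [b [r [[lb Kb _ ebr rx] [_ rK]]]] := pair_link x lx hx nyx.
  exists b, r; split=> //.
  suff <- : K x :\ y = K x by [].
  apply/setDidPl; rewrite disjoint_sym disjoints1 inE; apply/eqP; exact/nesym.
have bx := low_neq lb lx; have bY := low_neq lb ly.
have nyx : (y == x) = false by rewrite eq_sym (negbTE nxy).
have fx : f' x = s.+3 by rewrite f'E dx eqxx (negbTE nxy) addn0 addn1.
have fB z : z \in K b -> f' z = s.+1.
  rewrite inE => /eqP zb; rewrite f'E vdeg_low ?(cls_low zb) //.
  by rewrite !cls_neq ?zb ?addn0 //; exact/nesym.
have [a r1] : exists a, route e' f' s.+1 s.+1 (K b) a b.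
  by apply: clique_route_to; rewrite ?fB //; [exact: cl|move=> z /fB].
have r2 : route e' f' s.+2 s.+3 (K x) r x.
  apply: clique_route; rewrite ?fx ?inE ?rx //; first exact: cl.
  move=> z; rewrite inE => /eqP zx nzx.
  have [] := @pair_core z; rewrite ?(cls_low zx) ?(cls_hb zx) // => dz _.
  by rewrite f'E dz (negbTE nzx) cls_neq ?zx ?addn0.
have ry := route1 e' f' y.
have fy : s.+3 <= f' y by rewrite f'E eqxx addn1 ltnS nyx addn0 vdeg_high.
have d1 : [disjoint K x & [set y]].
  by rewrite disjoint_sym disjoints1 inE; apply/eqP/nesym.
have d2 : [disjoint K b & K x :|: [set y]].
  apply/pred0P => z; apply/negbTE/negP; rewrite /= !inE.
  by case/andP=> /eqP zb /orP[/eqP|/eqP E]; [rewrite zb|apply: bY; rewrite -zb E].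
have r3 := route_cat r2 ry exy' fy d1.
apply: completes_route (route_cat r1 r3 (ee' ebr) (leqnSn _) d2) _.
by rewrite !card_disjointU // cards1 Kb Kc addn1 double_succ.
Qed.

(** The path is [K y] ending at [y], the new edge to [x], then the whole core with the apex last:
    [s + 1 + (s + 1)] vertices. *)
Lemma completes_hub_full : low x -> hb x -> low y -> hb y ->
  completes e (2 * s + 2) x y.
Proof.
move=> lx hx ly hy; have Ky := hub_low ly hy.
have [c [w [[lw cw ncw exc exw] [[Kw dw dw2] _]]]] := hub_link lx hx.
have xw := low_neq lx lw; have yw := low_neq ly lw.
have nyx : (y == x) = false by rewrite eq_sym (negbTE nxy).
have fx : f' x = s.+2 by rewrite f'E vdeg_low // eqxx (negbTE nxy) addn0 addn1.
have fy : f' y = s.+2 by rewrite f'E vdeg_low // eqxx nyx addn0 addn1.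
have [a r1] : exists a, route e' f' s.+1 s.+2 (K y) a y.
  apply: clique_route_to; rewrite ?fy //; first exact: cl.
  move=> z; rewrite inE => /eqP zy zny.
  rewrite f'E vdeg_low ?(cls_low zy) // (negbTE zny) cls_neq ?zy ?addn0 //.
  exact/nesym.
have r2 : route e' f' s.+2 (f' w) (K w) c w.
  apply: clique_route; rewrite ?inE ?cw ?ncw //; first exact: cl.
    move=> z; rewrite inE => /eqP zw nzw.
    by rewrite f'E dw // !cls_neq ?zw ?addn0 //; exact/nesym.
  by rewrite f'E -addnA (leq_trans (vdeg_high lw)) ?leq_addr.
have rx := route1 e' f' x; rewrite fx in rx.
have d1 : [disjoint [set x] & K w] by rewrite disjoints1 inE; apply/eqP.
have d2 : [disjoint K y & [set x] :|: K w].
  apply/pred0P => z; apply/negbTE/negP; rewrite /= !inE.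
  by case/andP=> /eqP zy /orP[/eqP zx|/eqP]; [apply: cls_xy; rewrite -zx|rewrite zy].
have r3 := route_cat rx r2 (ee' exc) (leqnn _) d1.
apply: completes_route (route_cat r1 r3 eyx' (leqnn _) d2) _.
by rewrite !card_disjointU // cards1 Ky Kw double_succ add1n !addnS addSn.
Qed.

(** The path is a low class [K b], the core without its apex, then [x], then the apex:
    [s + s + 1 + 1] vertices. If [y] lies in the core, it is moved to between [x] and the apex,
    where the new edge reaches it. *)
Lemma completes_hub_sweep : low x -> hb x -> ~~ (low y && hb y) ->
  completes e (2 * s + 2) x y.
Proof.
move=> lx hx Ky.
have [c [w [[lw cw ncw exc exw] [[Kw dw dw2] link]]]] := hub_link lx hx.
have xw := low_neq lx lw.
have nyx : (y == x) = false by rewrite eq_sym (negbTE nxy).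
have yc : y != c by apply: contraNneq exy => ->.
have nyw : y != w by apply: contraNneq exy => ->.
have [b [r [[lb hb_b bx ebr rw] [nrw nry rK]]]] := link y yc.
have Kb := hub_low lb hb_b.
have bw := low_neq lb lw.
have yb : cls y <> cls b.
  by move=> E; move: Ky; rewrite (cls_low E) (cls_hb E) lb hb_b.
have fx : f' x = s.+2 by rewrite f'E vdeg_low // eqxx (negbTE nxy) addn0 addn1.
have fw : f' w = vdeg e w.
  by rewrite f'E (eq_sym w y) (negbTE nyw) cls_neq ?addn0 //; exact/nesym.
have fB z : z \in K b -> f' z = s.+1.
  rewrite inE => /eqP zb; rewrite f'E vdeg_low ?(cls_low zb) //.
  by rewrite !cls_neq ?zb ?addn0 //; exact/nesym.
have [a r1] : exists a, route e' f' s.+1 s.+1 (K b) a b.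
  by apply: clique_route_to; rewrite ?fB //; [exact: cl|move=> z /fB].
pose C := K w :\ w.
have dC z : z \in C -> vdeg e z = s.+2.
  by rewrite in_setD1 inE => /andP[zw /eqP E]; exact: dw.
have Cw z : z \in C -> cls z = cls w by rewrite in_setD1 inE => /andP[_ /eqP].
have r2 : route e' f' s.+2 s.+2 (C :\ y) r c.
  have fC z : z \in C :\ y -> f' z = s.+2.
    rewrite in_setD1 => /andP[zy zC]; rewrite f'E dC // (negbTE zy) cls_neq ?addn0 //.
    by rewrite (Cw _ zC); exact/nesym.
  have cS : c \in C :\ y by rewrite !inE eq_sym yc ncw cw eqxx.
  apply: clique_route => //; rewrite ?fC //.
  - by rewrite !inE nry nrw rw eqxx.
  - by apply: (@cl w); apply: (subset_trans (subD1set _ _)); exact: subD1set.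
  - by move=> z /fC.
have rx := route1 e' f' x; rewrite fx in rx.
have rw' := route1 e' f' w; rewrite fw in rw'.
have ecx : e' c x by apply: ee'; rewrite e_sym.
have xC : x \notin C by apply/negP=> /Cw.
have xB : x \notin K b by rewrite inE; apply/eqP/nesym.
have bK z : z \in K b -> (z \notin C) /\ (z != w).
  rewrite !inE => /eqP zb; split; last by apply/eqP=> E; apply: bw; rewrite -zb E.
  by rewrite zb; apply/negP=> /andP[_ /eqP].
have CE : #|C| = s by have := cardsD1 w (K w); rewrite Kx Kw => -[].
have nxw : x != w by apply/eqP=> E; apply: xw; rewrite E.
have wC : w \notin C by rewrite !inE eqxx.
case: (boolP (y \in C)) => yC; last first.
  have E : C :\ y = C by apply/setDidPl; rewrite disjoint_sym disjoints1.
  rewrite E in r2.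
  have d0 : [disjoint [set x] & [set w]] by rewrite disjoints1 inE.
  have d1 : [disjoint C & [set x] :|: [set w]].
    apply/pred0P => z; apply/negbTE/negP => /= /andP[zC].
    rewrite !in_setU !in_set1 => /orP[] /eqP E'; move: zC; rewrite E'.
      by rewrite (negbTE xC).
    by rewrite (negbTE wC).
  have d2 : [disjoint K b & C :|: ([set x] :|: [set w])].
    apply/pred0P => z; apply/negbTE/negP => /= /andP[zb]; have [zC zw] := bK _ zb.
    rewrite !in_setU !in_set1 (negbTE zC) (negbTE zw) orbF /= => /eqP E'.
    by rewrite -E' zb in xB.
  have r4 := route_cat rx rw' (ee' exw) (vdeg_high lw) d0.
  have r3 := route_cat r2 r4 ecx (leqnn _) d1.
  apply: completes_route (route_cat r1 r3 (ee' ebr) (leqnSn _) d2) _.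
  by rewrite !card_disjointU // !cards1 Kb CE double_succ addn2 !addnS addSn.
have fy : f' y = s.+3 by rewrite f'E dC // eqxx nyx addn0 addn1.
have ry' := route1 e' f' y; rewrite fy in ry'.
have eyw : e' y w by apply/ee'/cls_e; rewrite ?(Cw _ yC).
(* The raised [y] has degree [s + 3] and must precede the apex. For [s = 1] the core without its
   apex is the single vertex [c], which is not [y]. *)
have {}dw2 : s.+3 <= vdeg e w.
  case: dw2 => // s1; have := cardsD1 y C; have := cardsD1 c (C :\ y).
  have cC : c \in C by rewrite in_setD1 ncw inE cw eqxx.
  by rewrite in_setD1 eq_sym yc cC yC CE s1 => ->.
have d00 : [disjoint [set y] & [set w]] by rewrite disjoints1 inE.
have d0 : [disjoint [set x] & [set y] :|: [set w]].
  by rewrite disjoints1 !inE (negbTE nxy).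
have d1 : [disjoint C :\ y & [set x] :|: ([set y] :|: [set w])].
  apply/pred0P => z; apply/negbTE/negP => /=; rewrite in_setD1 => /andP[/andP[zy zC]].
  rewrite !in_setU !in_set1 (negbTE zy) /= => /orP[] /eqP E'; move: zC; rewrite E'.
    by rewrite (negbTE xC).
  by rewrite (negbTE wC).
have d2 : [disjoint K b & (C :\ y) :|: ([set x] :|: ([set y] :|: [set w]))].
  apply/pred0P => z; apply/negbTE/negP => /= /andP[zb]; have [zC zw] := bK _ zb.
  rewrite !in_setU !in_set1 in_setD1 (negbTE zC) (negbTE zw) andbF orbF /=.
  case/orP=> /eqP E'; first by rewrite -E' zb in xB.
  by move: zC; rewrite E' yC.
have r5 := route_cat ry' rw' eyw dw2 d00.
have r4 := route_cat rx r5 exy' (leqnSn _) d0.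
have r3 := route_cat r2 r4 ecx (leqnn _) d1.
apply: completes_route (route_cat r1 r3 (ee' ebr) (leqnSn _) d2) _.
have := cardsD1 y C; rewrite yC CE add1n => sE.
by rewrite !card_disjointU // !cards1 Kb double_succ sE !addnS addn0 !addSn.
Qed.

End Pair.

Lemma completes_low_pair x y : x != y -> ~~ e x y -> low x -> ~~ hb x ->
  completes e (2 * s + 2) x y.
Proof.
move=> nxy exy lx hx; case: (boolP (low y && (#|K y| == s.+1))).
  by case/andP=> ly /eqP Ky; exact: completes_pair_full.
by move=> H; apply: completes_pair_sweep => // ly Ky; rewrite ly Ky eqxx in H.
Qed.

Lemma completes_low x y : x != y -> ~~ e x y -> low x ->
  completes e (2 * s + 2) x y.
Proof.
move=> nxy exy lx; case: (boolP (hb x)) => hx; last exact: completes_low_pair.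
case: (boolP (low y && hb y)) => [/andP[ly hy]|H]; first exact: completes_hub_full.
exact: completes_hub_sweep.
Qed.

Lemma completes_nonadjacent x y : x != y -> ~~ e x y ->
  completes e (2 * s + 2) x y.
Proof.
move=> nxy exy; have nyx : y != x by rewrite eq_sym.
have eyx : ~~ e y x by rewrite e_sym.
case: (boolP (low x)) => lx; first exact: completes_low.
case: (boolP (low y)) => ly; first exact/completesC/completes_low.
case: (boolP (hb x)) => hx; last exact: completes_core.
case: (boolP (hb y)) => hy; last exact/completesC/completes_core.
by case/negP: exy; apply: cls_e => //; exact: hub_core.
Qed.

End Saturation.

(** * The pair block *)

(* The vertices of a pair block are numbered below [6 * s + 2]: cores [0, s) and
   [s, 2s), full low cliques [2s, 3s + 1), [3s + 1, 4s + 2) and [4s + 2, 5s + 3),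
   small low clique [5s + 3, 6s + 2). *)
Definition pcls (s v : nat) : nat :=
  if v < s then 0 else if v < 2 * s then 1 else if v < 3 * s + 1 then 2
  else if v < 4 * s + 2 then 3 else if v < 5 * s + 3 then 4 else 5.

(** Turns class equations into interval conditions that [lia] can handle. *)
Lemma pclsE s v :
  [/\ (pcls s v == 0) = (v < s), (pcls s v == 1) = (s <= v < 2 * s),
      (pcls s v == 2) = (2 * s <= v < 3 * s + 1) &
      (pcls s v == 3) = (3 * s + 1 <= v < 4 * s + 2)] /\
  (pcls s v == 4) = (4 * s + 2 <= v < 5 * s + 3) /\
  (pcls s v == 5) = (5 * s + 3 <= v).
Proof.
rewrite /pcls.
case: (ltnP v s) => ?; first by rewrite /=; do ?split; lia.
case: (ltnP v (2 * s)) => ?; first by rewrite /=; do ?split; lia.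
case: (ltnP v (3 * s + 1)) => ?; first by rewrite /=; do ?split; lia.
case: (ltnP v (4 * s + 2)) => ?; first by rewrite /=; do ?split; lia.
by case: (ltnP v (5 * s + 3)) => ?; rewrite /=; do ?split; lia.
Qed.

(* Give each core vertex [q] the three ports [q + 2s], [q + 4s], [q + 6s], which
   together fill [2s, 8s). A port below [6s + 2] is its own low vertex; the others
   are reduced modulo [s - 1] into the small clique. *)
Definition pcross (s q x : nat) : bool := (q < 2 * s) &&
  [|| x == q + 2 * s, x == q + 4 * s, (q < 2) && (x == q + 6 * s),
      (2 <= q <= s) && (x == q + 5 * s + 1) |
      (2 <= q) && (s < q) && (x == q + 4 * s + 2)].

Definition padj (s u v : nat) : bool :=
  (u != v) && [|| pcls s u == pcls s v, pcross s u v | pcross s v u].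

Lemma card_ord_seq N (P : pred nat) (l : seq nat) : uniq l ->
  (forall v, (v < N) && P v = (v \in l)) -> #|[set v : 'I_N | P v]| = size l.
Proof.
move=> ul H; rewrite cardE -(size_map val); apply/perm_size/uniq_perm => //.
  by rewrite map_inj_uniq; [exact: enum_uniq|exact: val_inj].
move=> v; rewrite -H; apply/mapP/andP => [[w]|[vN Pv]].
  by rewrite mem_enum inE => Pw ->; rewrite Pw ltn_ord.
by exists (Ordinal vN); rewrite // mem_enum inE.
Qed.

(** Listing the closed neighbourhood lets the class of [u] enter as one whole interval, without a
    gap at [u]. *)
Lemma card_ord_adj N (P : pred nat) (u : 'I_N) (l : seq nat) : uniq l -> ~~ P u ->
  (forall v, (v < N) && ((v == u) || P v) = (v \in l)) ->
  #|[set v : 'I_N | P v]| = (size l).-1.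
Proof.
move=> ul Pu H; rewrite -(card_ord_seq ul H).
rewrite [X in _ = X.-1](_ : _ = #|u |: [set v : 'I_N | P v]|).
  by rewrite cardsU1 inE Pu.
by apply: eq_card => v; rewrite !inE.
Qed.

(** Every class is an interval; the three cases are core, full low clique and small low clique, so
    that each degree count treats all classes of one kind at once. *)
Lemma pcls_seq s v : v < 6 * s + 2 -> exists a n,
  (forall z, z < 6 * s + 2 -> (pcls s z == pcls s v) = (a <= z < a + n)) /\
  [\/ v < 2 * s /\ n = s /\ a + n <= 2 * s,
      2 * s <= v < 5 * s + 3 /\ n = s.+1 /\ 2 * s <= a /\ a + n <= 5 * s + 3 |
      5 * s + 3 <= v /\ n = s.-1 /\ a = 5 * s + 3].
Proof.
move=> vN; have [[v0 v1 v2 v3] [v4 v5]] := pclsE s v.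
have E c z : (pcls s v == c) -> (pcls s z == pcls s v) = (pcls s z == c).
  by move/eqP=> ->.
case: (leqP s v) => ?; last first.
  exists 0, s; split; last by constructor 1; lia.
  by move=> z zN; have [[z0 _ _ _] _] := pclsE s z; rewrite (E 0) ?v0 ?z0.
case: (leqP (2 * s) v) => ?; last first.
  exists s, s; split; last by constructor 1; lia.
  by move=> z zN; have [[_ z1 _ _] _] := pclsE s z; rewrite (E 1) ?v1 ?z1; lia.
case: (leqP (3 * s + 1) v) => ?; last first.
  exists (2 * s), s.+1; split; last by constructor 2; lia.
  by move=> z zN; have [[_ _ z2 _] _] := pclsE s z; rewrite (E 2) ?v2 ?z2; lia.
case: (leqP (4 * s + 2) v) => ?; last first.
  exists (3 * s + 1), s.+1; split; last by constructor 2; lia.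
  by move=> z zN; have [[_ _ _ z3] _] := pclsE s z; rewrite (E 3) ?v3 ?z3; lia.
case: (leqP (5 * s + 3) v) => ?; last first.
  exists (4 * s + 2), s.+1; split; last by constructor 2; lia.
  by move=> z zN; have [_ [z4 _]] := pclsE s z; rewrite (E 4) ?v4 ?z4; lia.
exists (5 * s + 3), s.-1; split; last by constructor 3; lia.
by move=> z zN; have [_ [_ z5]] := pclsE s z; rewrite (E 5) ?v5 ?z5; lia.
Qed.

Lemma pcls_card s v : 0 < s -> v < 6 * s + 2 ->
  #|[set z : 'I_(6 * s + 2) | pcls s z == pcls s v]| =
  if v < 2 * s then s else if v < 5 * s + 3 then s.+1 else s.-1.
Proof.
move=> s0 vN; have [a [n [H K]]] := pcls_seq vN.
rewrite (@card_ord_seq _ (fun z => pcls s z == pcls s v) (iota a n)).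
- by rewrite size_iota; case: K; case: ifP => [|_]; try case: ifP; lia.
- exact: iota_uniq.
move=> z; rewrite mem_iota; case: (ltnP z (6 * s + 2)) => zN; first by rewrite H.
case: K; lia.
Qed.

Ltac seq_lia := rewrite ?mem_cat ?mem_iota ?inE; lia.
Ltac uniq_lia := rewrite cat_uniq iota_uniq /= ?mem_iota ?inE; lia.

Lemma padj_core s (u : 'I_(6 * s + 2)) : 0 < s -> u < 2 * s ->
  #|[set v : 'I_(6 * s + 2) | padj s u v]| = s + 2.
Proof.
move=> s0 u2; have uN := ltn_ord u.
have [a [n [H K]]] := pcls_seq uN.
have {K} [nE aE aN] : [/\ n = s, a <= u < a + s & a + s <= 2 * s].
  have ua : a <= u < a + n by rewrite -H.
  by case: K => K; split; lia.
(* The third port of [u], after its reduction into the small clique where needed. *)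
pose t := if u < 2 then u + 6 * s else if u <= s then u + 5 * s + 1 else u + 4 * s + 2.
have tE : 4 * s + u < t < 6 * s + 2 by rewrite /t; case: ifP; [lia|case: ifP; lia].
have cE v : pcross s u v = [|| v == u + 2 * s, v == u + 4 * s | v == t].
  rewrite /pcross u2 /t; case: ifP => ?; first lia.
  by case: ifP => ?; lia.
have cF v : pcross s v u = false by rewrite /pcross; lia.
rewrite (@card_ord_adj _ (padj s u) u (iota a n ++ [:: u + 2 * s; u + 4 * s; t])).
- by rewrite size_cat size_iota /=; lia.
- by uniq_lia.
- by rewrite /padj eqxx.
move=> v; rewrite /padj cE cF.
case: (ltnP v (6 * s + 2)) => vN; first by rewrite [pcls s u == _]eq_sym H //; seq_lia.
by seq_lia.
Qed.

Lemma padj_full s (u : 'I_(6 * s + 2)) : 0 < s -> 2 * s <= u < 5 * s + 3 ->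
  #|[set v : 'I_(6 * s + 2) | padj s u v]| = s.+1.
Proof.
move=> s0 u2; have uN := ltn_ord u.
have [a [n [H K]]] := pcls_seq uN.
have {K} [nE aE aN] : [/\ n = s.+1, 2 * s <= a & a + s.+1 <= 5 * s + 3].
  by case: K => K; split; lia.
have ua : a <= u < a + n by rewrite -H.
(* The ports of the three kinds fill consecutive intervals of length [2 * s]; subtracting the right
   offset recovers the one core vertex attached to [u]. *)
pose q := if u < 4 * s then u - 2 * s else if u < 6 * s then u - 4 * s else u - 6 * s.
have cE v : pcross s v u = (v == q).
  rewrite /pcross /q; case: ifP => ?; first lia.
  by case: ifP => ?; lia.
have q2 : q < 2 * s by rewrite /q; case: ifP; [lia|case: ifP; lia].
have cF v : pcross s u v = false by rewrite /pcross; lia.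
rewrite (@card_ord_adj _ (padj s u) u (iota a n ++ [:: q])).
- by rewrite size_cat size_iota /=; lia.
- by uniq_lia.
- by rewrite /padj eqxx.
move=> v; rewrite /padj cE cF.
case: (ltnP v (6 * s + 2)) => vN; first by rewrite [pcls s u == _]eq_sym H //; seq_lia.
by seq_lia.
Qed.

Lemma padj_small s (u : 'I_(6 * s + 2)) : 0 < s -> 5 * s + 3 <= u ->
  #|[set v : 'I_(6 * s + 2) | padj s u v]| = s.+1.
Proof.
move=> s0 u2; have uN := ltn_ord u.
have [a [n [H K]]] := pcls_seq uN.
have s2 : 1 < s by lia.
have {K} [nE aE] : n = s.-1 /\ a = 5 * s + 3.
  by case: K => K; split; lia.
(* [u] is an unreduced port of [q]; its other two neighbours are the core vertices whose third port
   reaches [u] after subtracting [s - 1] once or twice. *)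
pose q := if u < 6 * s then u - 4 * s else u - 6 * s.
have cE v : pcross s v u = [|| v == q, v == u - (5 * s + 1) | v == u - (4 * s + 2)].
  rewrite /pcross /q; case: (ltnP u (6 * s)) => ?; case: (ltnP v (2 * s)) => ? /=;
    case: (ltnP v 2) => ? /=; case: (leqP v s) => ? /=; lia.
have [q2 q3 q4] : [/\ q < 2 * s, q != u - (5 * s + 1) & q != u - (4 * s + 2)].
  by rewrite /q; case: ifP => ?; split; lia.
have cF v : pcross s u v = false by rewrite /pcross; lia.
rewrite (@card_ord_adj _ (padj s u) u
  (iota a n ++ [:: q; u - (5 * s + 1); u - (4 * s + 2)])).
- by rewrite size_cat size_iota /=; lia.
- by uniq_lia.
- by rewrite /padj eqxx.
move=> v; rewrite /padj cE cF.
case: (ltnP v (6 * s + 2)) => vN; first by rewrite [pcls s u == _]eq_sym H //; seq_lia.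
by seq_lia.
Qed.

(** * The hub block *)

(* The vertices are numbered below [3 * s + 1]: the classes [0, s) and [2s, 3s)
   are low, and the core consists of [s, 2s) and of the apex [3s]. *)
Definition hcls (s v : nat) : nat :=
  if v < s then 0 else if v < 2 * s then 1 else if v < 3 * s then 2 else 1.

(** The shifts by [s] are the edges along the copies of [P_3], with [[s, 2s)] as middle copy of
    [K_s]; the apex [3 * s] is joined to every low vertex. *)
Definition hcross (s c x : nat) : bool :=
  [&& hcls s c == 1, hcls s x != 1 & [|| c == 3 * s, c == x + s | x == c + s]].

Definition hadj (s u v : nat) : bool :=
  (u != v) && [|| hcls s u == hcls s v, hcross s u v | hcross s v u].

Lemma hclsE s v :
  [/\ (hcls s v == 0) = (v < s),
      (hcls s v == 1) = (s <= v < 2 * s) || (3 * s <= v) &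
      (hcls s v == 2) = (2 * s <= v < 3 * s)].
Proof.
rewrite /hcls.
case: (ltnP v s) => ?; first by rewrite /=; split; lia.
case: (ltnP v (2 * s)) => ?; first by rewrite /=; split; lia.
by case: (ltnP v (3 * s)) => ?; rewrite /=; split; lia.
Qed.

Lemma hcls_cases s v : v < 3 * s + 1 ->
  [\/ hcls s v = 0 /\ v < s, hcls s v = 2 /\ 2 * s <= v < 3 * s |
      hcls s v = 1 /\ (s <= v < 2 * s \/ v = 3 * s)].
Proof.
move=> vN; rewrite /hcls.
case: (ltnP v s) => ?; first by constructor 1.
case: (ltnP v (2 * s)) => ?; first by constructor 3; split=> //; left; lia.
case: (ltnP v (3 * s)) => ?; first by constructor 2; split=> //; lia.
by constructor 3; split=> //; right; lia.
Qed.

Lemma hcls_card s v : v < 3 * s + 1 ->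
  #|[set z : 'I_(3 * s + 1) | hcls s z == hcls s v]| =
  if hcls s v == 1 then s.+1 else s.
Proof.
move=> vN; case: (hcls_cases vN) => [[E _]|[E _]|[E _]].
- rewrite E (@card_ord_seq _ (fun z => hcls s z == 0) (iota 0 s)) ?iota_uniq ?size_iota //.
  by move=> z; have [-> _ _] := hclsE s z; rewrite mem_iota; lia.
- rewrite E (@card_ord_seq _ (fun z => hcls s z == 2) (iota (2 * s) s));
    rewrite ?iota_uniq ?size_iota //.
  by move=> z; have [_ _ ->] := hclsE s z; rewrite mem_iota; lia.
- rewrite E (@card_ord_seq _ (fun z => hcls s z == 1) (iota s s ++ [:: 3 * s])).
  + by rewrite size_cat size_iota addn1.
  + by uniq_lia.
  + by move=> z; have [_ -> _] := hclsE s z; seq_lia.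
Qed.

Lemma hadj_low s (u : 'I_(3 * s + 1)) : hcls s u != 1 ->
  #|[set v : 'I_(3 * s + 1) | hadj s u v]| = s.+1.
Proof.
move=> u1; have uN := ltn_ord u.
have cF v : hcross s u v = false by rewrite /hcross (negbTE u1).
have cE v : hcross s v u =
  [&& (s <= v < 2 * s) || (3 * s <= v) & [|| v == 3 * s, v == u + s | u == v + s :> nat]].
  by rewrite /hcross u1; have [_ -> _] := hclsE s v.
case: (hcls_cases uN) => [[E uE]|[E uE]|[E _]]; last by rewrite E in u1.
  rewrite (@card_ord_adj _ (hadj s u) u (iota 0 s ++ [:: u + s; 3 * s])).
  - by rewrite size_cat size_iota addn2.
  - by uniq_lia.
  - by rewrite /hadj eqxx.
  move=> v; rewrite /hadj cF cE E [0 == _]eq_sym; have [-> _ _] := hclsE s v.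
  by seq_lia.
rewrite (@card_ord_adj _ (hadj s u) u (iota (2 * s) s ++ [:: u - s; 3 * s])).
- by rewrite size_cat size_iota addn2.
- by uniq_lia.
- by rewrite /hadj eqxx.
move=> v; rewrite /hadj cF cE E [2 == _]eq_sym; have [_ _ ->] := hclsE s v.
by seq_lia.
Qed.

Lemma hadj_core s (u : 'I_(3 * s + 1)) : s <= u < 2 * s ->
  #|[set v : 'I_(3 * s + 1) | hadj s u v]| = s + 2.
Proof.
move=> us; have uN := ltn_ord u.
have u1 : hcls s u == 1 by have [_ -> _] := hclsE s u; rewrite us.
have cF v : hcross s v u = false by rewrite /hcross u1 andbF.
rewrite (@card_ord_adj _ (hadj s u) u (iota s s ++ [:: 3 * s; u - s; u + s])).
- by rewrite size_cat size_iota /=; lia.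
- by uniq_lia.
- by rewrite /hadj eqxx.
move=> v; rewrite /hadj cF /hcross u1 (eqP u1) [1 == _]eq_sym.
by have [_ -> _] := hclsE s v; seq_lia.
Qed.

Lemma hadj_apex s (u : 'I_(3 * s + 1)) : u = 3 * s :> nat ->
  #|[set v : 'I_(3 * s + 1) | hadj s u v]| = 3 * s.
Proof.
move=> us.
have u1 : hcls s u == 1 by have [_ -> _] := hclsE s u; rewrite us leqnn orbT.
rewrite (@card_ord_adj _ (hadj s u) u (iota 0 (3 * s + 1))).
- by rewrite size_iota addn1.
- exact: iota_uniq.
- by rewrite /hadj eqxx.
move=> v; rewrite /hadj /hcross u1 (eqP u1) us !eqxx [1 == _]eq_sym mem_iota.
by case: (hcls s v == 1) => /=; lia.
Qed.

(** * Entries from low cliques into cores *)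

(** Among [a], [a + 1], [a + 2] at most two are excluded as [y] or [c]. When the interval is too
    short for this, [r = c] is allowed because nothing but [c] remains after removing [y]. The bound
    [r < a + 3] is what later places a port of [r] in a prescribed clique. *)
Lemma pick_core s a c y : 0 < s -> a <= c < a + s -> y != c -> exists r,
  [/\ a <= r < a + s, r < a + 3, r != y &
      (r != c) || (s == 1) || ((s == 2) && (a <= y < a + s))].
Proof.
move=> s0 ac yc.
pose ok r := [&& r < a + s, r != y &
  (r != c) || (s == 1) || ((s == 2) && (a <= y < a + s))].
case: (boolP (ok a)) => [/and3P[? ? ?]|]; first by exists a; split=> //; lia.
case: (boolP (ok a.+1)) => [/and3P[? ? ?]|]; first by exists a.+1; split=> //; lia.
case: (boolP (ok a.+2)) => [/and3P[? ? ?]|]; first by exists a.+2; split=> //; lia.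
by rewrite /ok; lia.
Qed.

(** The chosen core vertex [r] has ports in two different full low cliques, and at most one of them
    carries the class number of [x]. *)
Lemma pcross_link s x c y : 0 < s -> c < 2 * s -> y != c -> exists b r,
  [/\ 2 * s <= b < 5 * s + 3, pcls s b != pcls s x, pcross s r b,
      pcls s r == pcls s c & r < 2 * s] /\ r != y /\
  (r != c) || (s == 1) || ((s == 2) && (pcls s y == pcls s c)).
Proof.
move=> s0 c2 yc.
have [[c0 c1 _ _] _] := pclsE s c.
have [[y0 y1 _ _] _] := pclsE s y.
case: (ltnP c s) => cs.
  have cE : pcls s c = 0 by apply/eqP; rewrite c0.
  have [r [rs r3 ry rc]] : exists r, [/\ 0 <= r < 0 + s, r < 0 + 3, r != y &
      (r != c) || (s == 1) || ((s == 2) && (0 <= y < 0 + s))].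
    by apply: pick_core => //; lia.
  have rE : pcls s r == pcls s c by rewrite cE; have [[-> _ _ _] _] := pclsE s r.
  have rc' : (r != c) || (s == 1) || ((s == 2) && (pcls s y == pcls s c)).
    by rewrite cE y0.
  case: (eqVneq (pcls s x) 2) => xE.
    exists (r + 4 * s), r; do !split=> //; rewrite ?xE /pcross; try lia.
    by have [[_ _ -> _] _] := pclsE s (r + 4 * s); lia.
  exists (r + 2 * s), r; do !split=> //; rewrite /pcross; try lia.
  suff /eqP -> : pcls s (r + 2 * s) == 2 by rewrite eq_sym.
  by have [[_ _ -> _] _] := pclsE s (r + 2 * s); lia.
have cE : pcls s c = 1 by apply/eqP; rewrite c1 cs.
have [r [rs r3 ry rc]] := @pick_core s s c y s0 ltac:(lia) yc.
have rE : pcls s r == pcls s c.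
  by rewrite cE; have [[_ -> _ _] _] := pclsE s r; lia.
have rc' : (r != c) || (s == 1) || ((s == 2) && (pcls s y == pcls s c)).
  by rewrite cE y1 mul2n -addnn.
case: (eqVneq (pcls s x) 4) => xE.
  exists (r + 2 * s), r; do !split=> //; rewrite ?xE /pcross; try lia.
  by have [_ [-> _]] := pclsE s (r + 2 * s); lia.
(* A port of [r] in the last full clique. Since [s <= r < s + 3], the second port lies there for
   [s >= 2]; for [s = 1] it falls short and the third one is used. *)
pose b := if s == 1 then r + 6 * s else r + 4 * s.
have bE : 4 * s + 2 <= b < 5 * s + 3 by rewrite /b; case: ifP; lia.
exists b, r; do !split=> //; rewrite ?/pcross.
- lia.
- suff /eqP -> : pcls s b == 4 by rewrite eq_sym.
  by have [_ [-> _]] := pclsE s b.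
- have r2 : r < 2 * s by lia.
  have [->|[s1 ->]] : b = r + 4 * s \/ s = 1 /\ b = r + 6 * s.
    by rewrite /b; case: eqP; [right|left].
  - by rewrite r2 eqxx orbT.
  - have r1 : r < 2 by move: r2; rewrite s1.
    by rewrite r2 r1 eqxx !orbT.
- lia.
Qed.

Lemma pcross_nbr s x : 0 < s -> 2 * s <= x < 6 * s + 2 ->
  exists2 c, c < 2 * s & pcross s c x.
Proof.
move=> s0 xN; case: (ltnP x (4 * s)) => x4.
  by exists (x - 2 * s); rewrite /pcross; lia.
case: (ltnP x (6 * s)) => x6; first by exists (x - 4 * s); rewrite /pcross; lia.
by exists (x - 6 * s); rewrite /pcross; lia.
Qed.

(** [c] is the middle vertex of the copy of [P_3] through [x], and [b] is the end of the copy
    through [r] on the side opposite to [x]. *)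
Lemma hcross_link s x : 0 < s -> x < 3 * s + 1 -> hcls s x != 1 ->
  exists2 c, s <= c < 2 * s & hcross s c x /\
  forall y, y != c -> exists b r,
    [/\ b < 3 * s + 1, s <= r < 2 * s, hcls s b != 1, hcls s b != hcls s x & hcross s r b] /\
    r != y /\ (r != c) || (s == 1) || ((s == 2) && (s <= y < 2 * s)).
Proof.
move=> s0 xN x1.
have E r : s <= r < 2 * s -> hcls s r == 1 by have [_ -> _] := hclsE s r => ->.
case: (hcls_cases xN) => [[xE xs]|[xE xs]|[xE _]]; last by rewrite xE in x1.
  exists (x + s); first lia.
  split; first by rewrite /hcross x1 E ?eqxx ?orbT //; lia.
  move=> y yc; have [r [rs r3 ry rc]] := @pick_core s s (x + s) y s0 ltac:(lia) yc.
  exists (r + s), r.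
  have bE : hcls s (r + s) = 2.
    by apply/eqP; have [_ _ ->] := hclsE s (r + s); lia.
  split; last by split=> //; rewrite mul2n -addnn.
  rewrite /hcross bE xE E ?eqxx ?orbT //; last lia.
  by split=> //; lia.
exists (x - s); first lia.
split; first by rewrite /hcross x1 E; lia.
move=> y yc; have [r [rs r3 ry rc]] := @pick_core s s (x - s) y s0 ltac:(lia) yc.
exists (r - s), r.
have bE : hcls s (r - s) = 0.
  by apply/eqP; have [-> _ _] := hclsE s (r - s); lia.
split; last by split=> //; rewrite mul2n -addnn.
rewrite /hcross bE xE E ?eqxx ?orbT //; last lia.
by split=> //; lia.
Qed.

(** * The disjoint union of the blocks *)

Section Construction.
Variables (s r h0 : nat).
Hypotheses (s_gt0 : 0 < s) (h0E : h0 = 0 \/ h0 = 3 * s + 1).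

(** With [h0] equal to [0] or [3 * s + 1], one type covers the unions with and without a hub
    block. *)
Definition vertex := ('I_r * 'I_(6 * s + 2) + 'I_h0)%type.

Definition adj : rel vertex := fun x y =>
  match x, y with
  | inl (i, u), inl (j, v) => (i == j) && padj s u v
  | inr u, inr v => hadj s u v
  | _, _ => false
  end.

Definition cls (x : vertex) : option 'I_r * nat :=
  match x with
  | inl (i, u) => (Some i, pcls s u)
  | inr u => (None, hcls s u)
  end.

Definition low (x : vertex) : bool :=
  match x with inl (_, u) => 2 * s <= u | inr u => hcls s u != 1 end.

Definition in_hub (x : vertex) : bool := if x is inr _ then true else false.

Definition block i (u : 'I_(6 * s + 2)) : vertex := inl (i, u).
Definition hub (u : 'I_h0) : vertex := inr u.

Lemma card_block i (P : pred nat) (S : {set vertex}) :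
  (forall z, z \in S = if z is inl (j, u) then (i == j) && P u else false) ->
  #|S| = #|[set u : 'I_(6 * s + 2) | P u]|.
Proof.
move=> H; have inj : injective (block i) by move=> u v [].
rewrite -(card_imset _ inj); apply: eq_card => z; rewrite H.
apply/idP/imsetP => [|[u]]; last by rewrite inE => Pu -> /=; rewrite eqxx.
by case: z => // [[j u]] /andP[/eqP <- Pu]; exists u; rewrite // inE.
Qed.

Lemma card_hub (P : pred nat) (S : {set vertex}) :
  (forall z, z \in S = if z is inr u then P (nat_of_ord u) else false) ->
  #|S| = #|[set u : 'I_h0 | P u]|.
Proof.
move=> H; have inj : injective hub by move=> u v [].
rewrite -(card_imset _ inj); apply: eq_card => z; rewrite H.
apply/idP/imsetP => [|[u]]; last by rewrite inE => Pu ->.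
by case: z => // u Pu; exists u; rewrite // inE.
Qed.

Lemma cls_card_block i u : #|[set z | cls z == cls (inl (i, u))]| =
  if u < 2 * s then s else if u < 5 * s + 3 then s.+1 else s.-1.
Proof.
rewrite -pcls_card //; apply: (@card_block i (fun v => pcls s v == pcls s u)) => z.
by rewrite inE; case: z => [[j v]|v] //=; rewrite xpair_eqE eq_sym.
Qed.

Lemma hub_size (u : 'I_h0) : h0 = 3 * s + 1.
Proof. by case: h0E => // E; have := ltn_ord u; rewrite [X in _ < X]E. Qed.

Lemma hub_lt (u : 'I_h0) : u < 3 * s + 1.
Proof. by rewrite -(hub_size u) ltn_ord. Qed.

Lemma cls_card_hub u : #|[set z | cls z == cls (inr u)]| =
  if hcls s u == 1 then s.+1 else s.
Proof.
rewrite -(hcls_card (hub_lt u)) -(hub_size u).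
apply: (@card_hub (fun v => hcls s v == hcls s u)) => z.
by rewrite inE; case: z => [[j v]|v].
Qed.

Lemma vdeg_block i u : vdeg adj (inl (i, u)) = s.+1 + (u < 2 * s).
Proof.
rewrite /vdeg (@card_block i (padj s u)); last first.
  by move=> z; rewrite inE; case: z => [[j v]|v].
case: (ltnP u (2 * s)) => u2; first by rewrite padj_core // addn1 addn2.
rewrite addn0; case: (ltnP u (5 * s + 3)) => u5; first by rewrite padj_full ?u2.
by rewrite padj_small.
Qed.

(** The last summand raises the apex from [s + 1] to [3 * s]. *)
Lemma vdeg_hub u : vdeg adj (inr u) =
  s.+1 + (s <= u < 2 * s) + (u == 3 * s :> nat) * (2 * s - 1).
Proof.
rewrite /vdeg (@card_hub (hadj s u)); last first.
  by move=> z; rewrite inE; case: z => [[j v]|v].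
move: (hub_size u) (u) => E {}u; move: u; rewrite E => u.
case: (hcls_cases (ltn_ord u)) => [[Eu us]|[Eu us]|[Eu [us|us]]].
- by rewrite hadj_low ?Eu //; lia.
- by rewrite hadj_low ?Eu //; lia.
- by rewrite hadj_core //; lia.
- by rewrite hadj_apex //; lia.
Qed.

Lemma adj_sym : symmetric adj.
Proof.
move=> [[i u]|u] [[j v]|v] //=.
  by rewrite /padj eq_sym [pcls s u == _]eq_sym [_ || pcross _ _ _]orbC [u == v :> nat]eq_sym.
by rewrite /hadj [hcls s u == _]eq_sym [_ || hcross _ _ _]orbC [u == v :> nat]eq_sym.
Qed.

Lemma adj_irr : irreflexive adj.
Proof. by move=> [[i u]|u] /=; rewrite ?/padj ?/hadj !eqxx //. Qed.

Lemma pcls_low u v : pcls s u = pcls s v -> (2 * s <= u) = (2 * s <= v).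
Proof.
move=> E; have E' w : (2 * s <= w) = ~~ ((pcls s w == 0) || (pcls s w == 1)).
  by have [[-> -> _ _] _] := pclsE s w; lia.
by rewrite !E' E.
Qed.

Lemma cls_low x y : cls x = cls y -> low x = low y.
Proof.
case: x y => [[i u]|u] [[j v]|v] //= [].
  by move=> _; exact: pcls_low.
by move=> ->.
Qed.

Lemma cls_in_hub x y : cls x = cls y -> in_hub x = in_hub y.
Proof. by case: x y => [[i u]|u] [[j v]|v]. Qed.

Lemma cls_adj x y : cls x = cls y -> x != y -> adj x y.
Proof.
case: x y => [[i u]|u] [[j v]|v] //= [].
  move=> -> E ne; rewrite eqxx /padj E eqxx !andbT /=.
  by apply: contraNneq ne => /val_inj ->.
move=> E ne; rewrite /hadj E eqxx !andbT /=.
by apply: contraNneq ne => /val_inj ->.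
Qed.

Lemma pcross_low q x : pcross s q x -> q < 2 * s <= x.
Proof. by rewrite /pcross; lia. Qed.

Lemma adj_cls x y : adj x y -> low x = low y -> cls x = cls y.
Proof.
case: x y => [[i u]|u] [[j v]|v] //=.
  case/andP=> /eqP -> /andP[_ /or3P[/eqP -> //|/pcross_low|/pcross_low]]; lia.
case/andP=> _ /or3P[/eqP -> //||].
  by rewrite /hcross => /and3P[-> ->].
by rewrite /hcross => /and3P[-> ->].
Qed.

Lemma vdeg_low x : low x -> vdeg adj x = s.+1.
Proof.
case: x => [[i u]|u] /= l; first by rewrite vdeg_block ltnNge l addn0.
have [_ E1 _] := hclsE s u; move: l; rewrite E1 vdeg_hub; lia.
Qed.

Lemma vdeg_high x : ~~ low x -> s.+2 <= vdeg adj x.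
Proof.
case: x => [[i u]|u] /= l; first by rewrite vdeg_block [u < _]ltnNge (negbTE l) addn1.
have uN := hub_lt u.
have [_ E1 _] := hclsE s u; move: l; rewrite E1 vdeg_hub; lia.
Qed.

Lemma adj_size x y : adj x y -> low x -> ~~ low y ->
  #|[set z | cls z == cls x]| + #|[set z | cls z == cls y]| <= 2 * s + 1.
Proof.
case: x y => [[i u]|u] [[j v]|v] //= _; rewrite ?cls_card_block ?cls_card_hub.
  by rewrite -ltnNge => + ->; rewrite ltnNge => -> /=; case: ifP; lia.
by move=> /negbTE -> /negPn ->; lia.
Qed.

Lemma cls_size x : #|[set z | cls z == cls x]| <= 2 * s + 1.
Proof.
case: x => [[i u]|u]; rewrite ?cls_card_block ?cls_card_hub.
  by case: ifP => _; [lia|case: ifP => _; lia].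
by case: ifP => _; lia.
Qed.

Lemma adj_pair_core u : ~~ low u -> ~~ in_hub u ->
  vdeg adj u = s.+2 /\ #|[set z | cls z == cls u]| = s.
Proof.
case: u => [[i u]|u] //=; rewrite -ltnNge => u2 _.
by rewrite vdeg_block cls_card_block u2 addn1.
Qed.

Lemma adj_pair_nbr x : low x -> ~~ in_hub x ->
  exists c, [/\ ~~ low c, ~~ in_hub c & adj x c].
Proof.
case: x => [[i u]|u] //= u2 _.
have [|c c2 uc] := @pcross_nbr s u s_gt0; first by rewrite u2 ltn_ord.
have cN : c < 6 * s + 2 by lia.
exists (inl (i, Ordinal cN)); split=> //=; first by rewrite -ltnNge.
rewrite eqxx /padj /= uc !orbT andbT; lia.
Qed.

Lemma adj_pair_link x c y : ~~ low c -> ~~ in_hub c -> y != c ->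
  exists b q, [/\ low b, #|[set z | cls z == cls b]| = s.+1, cls b <> cls x,
    adj b q & cls q = cls c] /\
    q != y /\ (q != c) || (#|[set z | cls z == cls c] :\ y| <= 1).
Proof.
case: c => [[i c]|c] //=; rewrite -ltnNge => c2 _ yc.
(* Only the class number of [x] is avoided, whichever pair block contains it; [0] is a default for
   [x] in the hub. *)
pose x' := if x is inl (j, u) then (u : nat) else 0.
(* The default [6 * s + 2] for [y] outside block [i] is not the number of a vertex and its class
   number is not that of a core. *)
pose y' := if y is inl (j, u) then (if i == j then (u : nat) else 6 * s + 2) else 6 * s + 2.
have y'c : y' != c.
  rewrite /y'; case: (y) yc => [[j u]|u] yc; last by lia.
  case: (eqVneq i j) => [E|_]; last by lia.
  by apply: contraNneq yc => /val_inj ->; rewrite E.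
have [b [q [[b2 bx qb qc q2] [qy qK]]]] := @pcross_link s x' c y' s_gt0 c2 y'c.
have bN : b < 6 * s + 2 by lia.
have qN : q < 6 * s + 2 by lia.
exists (inl (i, Ordinal bN)), (inl (i, Ordinal qN)); split; first split.
- by rewrite /=; case/andP: b2.
- rewrite cls_card_block /=; case/andP: b2 => b2 b5.
  by rewrite ltnNge b2 /= b5.
- rewrite /x' in bx; case: (x) bx => [[j u]|u] //= bx [_ E].
  by rewrite E eqxx in bx.
- by rewrite /= eqxx /padj qb !orbT andbT /=; lia.
- by rewrite /= (eqP qc).
split.
  by apply: contraNneq qy => E; rewrite /y' -E /= eqxx.
case/orP: qK => [/orP[qc'|/eqP s1]|/andP[/eqP s2 yK]].
- by rewrite (_ : _ != _) //; apply: contraNneq qc' => -[<-].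
- apply/orP; right; apply: leq_trans (subset_leq_card (subsetDl _ _)) _.
  by rewrite cls_card_block c2 s1.
- apply/orP; right.
  have yK' : y \in [set z | cls z == cls (inl (i, c))].
    rewrite inE; move: yK; rewrite /y'.
    have N5 : (pcls s (6 * s + 2) == pcls s c) = false.
      apply/negP => /eqP /pcls_low; lia.
    case: (y) => [[j u]|u] //=; last by rewrite N5.
    by case: (eqVneq i j) => [->|_ /=]; rewrite ?N5 // => /eqP ->.
  have := cardsD1 y [set z | cls z == cls (inl (i, c))].
  rewrite yK' cls_card_block c2 => E.
  (* [true] is the summand 1 that [cardsD1] gives for the member [y]; the core has [s = 2]
     vertices. *)
  by rewrite -(leq_add2l true) -E (eq_leq s2).
Qed.

Lemma adj_hub_core u v : ~~ low u -> ~~ low v -> in_hub u -> in_hub v -> cls u = cls v.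
Proof. by case: u v => [[i u]|u] [[j v]|v] //= /negPn/eqP -> /negPn/eqP ->. Qed.

Lemma adj_hub_low x : low x -> in_hub x -> #|[set z | cls z == cls x]| = s.
Proof. by case: x => [[i u]|u] //= /negbTE E _; rewrite cls_card_hub E. Qed.

Lemma adj_hub_link x : low x -> in_hub x -> exists c w,
  [/\ ~~ low w, cls c = cls w, c != w, adj x c & adj x w] /\
  [/\ #|[set z | cls z == cls w]| = s.+1,
    forall u, cls u = cls w -> u != w -> vdeg adj u = s.+2 &
    s = 1 \/ s.+3 <= vdeg adj w] /\
  forall y, y != c -> exists b q,
    [/\ low b, in_hub b, cls b <> cls x, adj b q & cls q = cls w] /\
    [/\ q != w, q != y & (q != c) || (#|[set z | cls z == cls w] :\ w :\ y| <= 1)].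
Proof.
case: x => [[i u]|u] //= u1 _.
have h0E' := hub_size u; have uN := hub_lt u.
have [c c2 [cu link]] := hcross_link s_gt0 uN u1.
have cN : c < h0 by lia.
have wN : 3 * s < h0 by lia.
have w1 : hcls s (3 * s) = 1.
  by apply/eqP; have [_ -> _] := hclsE s (3 * s); rewrite leqnn orbT.
have C1 v : s <= v < 2 * s -> hcls s v = 1.
  by move=> vs; apply/eqP; have [_ -> _] := hclsE s v; rewrite vs.
have u3 : (u : nat) != 3 * s by apply: contraNneq u1 => ->; rewrite w1.
exists (hub (Ordinal cN)), (hub (Ordinal wN)); split; [split|split; [split|]].
- by rewrite /= w1.
- by rewrite /= w1 C1.
- by apply/eqP => -[]; lia.
- rewrite /= /hadj cu !orbT andbT /=; apply: contraNneq u1 => ->.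
  by rewrite C1.
- by rewrite /= /hadj u3 /hcross w1 u1 !eqxx /= ?orbT.
- by rewrite cls_card_hub /= w1.
- case=> [[j v]|v] //= [E] vw; rewrite vdeg_hub.
  have vN := hub_lt v.
  have vw' : (v : nat) != 3 * s.
    by apply: contraNneq vw => E'; apply/eqP; congr inr; apply: val_inj.
  have [_ E1 _] := hclsE s v; move: E1; rewrite E w1 eqxx; lia.
- by rewrite vdeg_hub /=; lia.
(* Outside the hub the default is the apex number, which differs from [c] and lies outside
   [[s, 2s)]. *)
move=> y yc; pose y' := if y is inr v then (v : nat) else 3 * s.
have y'c : y' != c.
  rewrite /y'; case: (y) yc => [[j v]|v] yc; first by lia.
  by apply: contraNneq yc => E; apply/eqP; congr inr; apply: val_inj.
have [b [q [[bN' q2 b1 bu qb] [qy qK]]]] := link y' y'c.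
have bN : b < h0 by rewrite h0E'.
have qN : q < h0 by lia.
exists (hub (Ordinal bN)), (hub (Ordinal qN)); split; split.
- by rewrite /= b1.
- by [].
- by move=> [E]; rewrite E eqxx in bu.
- rewrite /= /hadj qb !orbT andbT /=; apply: contraNneq b1 => ->.
  by rewrite C1.
- by rewrite /= w1 C1.
- by apply/eqP => -[]; lia.
- by apply: contraNneq qy => E; rewrite /y' -E.
have wK : hub (Ordinal wN) \in [set z | cls z == cls (hub (Ordinal wN))] by rewrite inE.
have := cardsD1 (hub (Ordinal wN)) [set z | cls z == cls (hub (Ordinal wN))].
rewrite wK cls_card_hub (_ : hcls s (Ordinal wN) = 1) // eqxx add1n => -[sE].
case/orP: qK => [/orP[qc'|/eqP s1]|/andP[/eqP s2 yK]].
- by rewrite (_ : _ != _) //; apply: contraNneq qc' => -[<-].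
- apply/orP; right; apply: leq_trans (subset_leq_card (subsetDl _ _)) _.
  by rewrite -sE s1.
- apply/orP; right.
  have yK' : y \in [set z | cls z == cls (hub (Ordinal wN))] :\ hub (Ordinal wN).
    move: yK; rewrite /y' !inE; case: (y) => [[j v]|v] /= yK; first lia.
    rewrite w1 C1 // eqxx andbT; apply/eqP => -[E]; move: yK; rewrite E /=; lia.
  have := cardsD1 y ([set z | cls z == cls (hub (Ordinal wN))] :\ hub (Ordinal wN)).
  by rewrite yK' -sE => E; rewrite -(leq_add2l true) -E (eq_leq s2).
Qed.

(** * Numbers of vertices and edges *)

Lemma card_vertex : #|{: vertex}| = r * (6 * s + 2) + h0.
Proof. by rewrite card_sum card_prod !card_ord. Qed.

Lemma sum_vdeg : \sum_x vdeg adj x <=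
  r * ((6 * s + 2) * s.+1 + 2 * s) + (0 < h0) * (s * (3 * s + 7)).
Proof.
rewrite big_sumType /=; apply: leq_add.
  rewrite (eq_bigr (fun p : 'I_r * 'I_(6 * s + 2) => s.+1 + (p.2 < 2 * s))); last first.
    by move=> [i u] _; exact: vdeg_block.
  rewrite -(pair_big predT predT (fun i (u : 'I_(6 * s + 2)) => s.+1 + (u < 2 * s))) /=.
  rewrite sum_nat_const card_ord leq_mul2l; apply/orP; right.
  rewrite big_split sum_nat_const card_ord /= leq_add2l.
  rewrite -big_mkcond /= sum1_card -[X in _ <= X](size_iota 0).
  rewrite -(@card_ord_seq (6 * s + 2) (fun v => v < 2 * s)) ?iota_uniq //.
    by apply/eq_leq/eq_card => v; rewrite inE.
  by move=> v; rewrite mem_iota; lia.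
rewrite (eq_bigr _ (fun u _ => vdeg_hub u)).
case: h0E => E; rewrite E; first by rewrite big_ord0.
rewrite addn1 mul1n big_ord_recr /=.
rewrite (eq_bigr (fun u : 'I_(3 * s) => s.+1 + (s <= u < 2 * s))); last first.
  by move=> u _; rewrite (ltn_eqF (ltn_ord u)) addn0.
rewrite big_split sum_nat_const card_ord /= -big_mkcond /= sum1_card.
rewrite (_ : #|_| = s); first by rewrite eqxx; nia.
rewrite -[RHS](size_iota s) -(@card_ord_seq (3 * s) (fun v => s <= v < 2 * s)).
- by apply/eq_card => v; rewrite inE.
- exact: iota_uniq.
- by move=> v; rewrite mem_iota; lia.
Qed.

Lemma construction_bound : 2 * h (r * (6 * s + 2) + h0) (2 * s + 2) <=
  r * ((6 * s + 2) * s.+1 + 2 * s) + (0 < h0) * (s * (3 * s + 7)).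
Proof.
apply: leq_trans sum_vdeg; rewrite -card_vertex.
apply: h_le_vdeg; [exact: adj_sym|exact: adj_irr| |].
  move=> p; have -> : 2 * s + 2 - 1 = 2 * s + 1 by lia.
  apply: (@dmp_bound _ _ adj low cls).
  - exact: cls_low.
  - exact: adj_cls.
  - by move=> x y _ hx ly; rewrite (vdeg_low ly); exact: vdeg_high.
  - exact: cls_size.
  - exact: adj_size.
move=> x y; apply: (@completes_nonadjacent _ _ adj cls low in_hub).
- exact: adj_sym.
- exact: cls_low.
- exact: cls_in_hub.
- exact: cls_adj.
- exact: vdeg_low.
- exact: vdeg_high.
- exact: adj_pair_core.
- exact: adj_pair_nbr.
- exact: adj_pair_link.
- exact: adj_hub_core.
- exact: adj_hub_low.
- exact: adj_hub_link.
Qed.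

End Construction.

(* h(n,k) <= n(3k+8)(k-2) / (4(3k-4)), cleared of denominators *)
Theorem theorem2p7 (k n : nat) :
  4 <= k -> ~~ odd k -> 0 < n -> ((3 * k - 4)./2 %| n) ->
  4 * (3 * k - 4) * h n k <= n * (3 * k + 8) * (k - 2).
Proof.
move=> k4 ek n0 /dvdnP[m nE].
have [s kE] : exists s, k = 2 * s + 2 by exists (k./2.-1); lia.
have s0 : 0 < s by lia.
have tE : (3 * k - 4)./2 = 3 * s + 1 by lia.
(* Two units of [3 * s + 1] vertices make one pair block; an odd unit left over becomes the hub
   block. *)
have nE' : n = m./2 * (6 * s + 2) + odd m * (3 * s + 1).
  by rewrite nE tE -{1}(odd_double_half m) -muln2; lia.
have h0E : odd m * (3 * s + 1) = 0 \/ odd m * (3 * s + 1) = 3 * s + 1.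
  by case: (odd m); lia.
have := construction_bound (m./2) s0 h0E.
rewrite -nE' -kE => H.
(* The claimed bound is the edge count of [m] hub blocks, each of degree sum [s * (3 * s + 7)]. *)
have {}H : 2 * h n k <= m * (s * (3 * s + 7)).
  apply: leq_trans H _; rewrite -{3}(odd_double_half m) -muln2.
  rewrite [X in _ <= X]mulnDl [X in _ <= X]addnC.
  apply: leq_add; last by case: (odd m); rewrite ?addn1.
  (* A pair block costs no more than two hub blocks: the difference of the degree sums is
     [4 * s - 2]. *)
  rewrite -mulnA leq_mul2l; apply/orP; right; move: s0; clear; nia.
have -> : n * (3 * k + 8) * (k - 2) = 4 * (3 * s + 1) * (m * (s * (3 * s + 7))).
  rewrite nE tE kE; clear; nia.
have -> : 4 * (3 * k - 4) * h n k = 4 * (3 * s + 1) * (2 * h n k).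
  rewrite kE; clear; nia.
by rewrite leq_mul2l H orbT.
Qed.
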